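(* Let $f,g,F,G$ be four standard real polynomials satisfying the following conditions. (a) $F(x)=a(x)f(x)+b(x)g(x)$ and $G(x)=c(x)f(x)+d(x)g(x)$, where $a(x),b(x),c(x),d(x)$ are real polynomials, such that $\deg F=\deg G$ or $\deg F=\deg G+1$. (b) $f,g\in\mathrm{RZ}$ and $g\preceq f$. (c) $\Delta(x):=a(x)d(x)-b(x)c(x)\ge 0$ whenever $G(x)=0$. Suppose that either $c(x)$ is a positive constant and $\deg G\le\deg g+1$, or $d(x)$ is a positive constant and $\deg G\le\deg f$. Then $F,G\in\mathrm{RZ}$ and $G\preceq F$. In particular, if $g\prec f$ and $\Delta(x)>0$ whenever $G(x)=0$, then $G\prec F$.
   Context: A real polynomial is standard if either it is identically zero or its leading coefficient is positive. $\mathrm{RZ}$ denotes the set of real polynomials with only real zeros. For $f,g\in\mathrm{RZ}$, let $\{r_i\}$ and $\{s_j\}$ be all zeros (with multiplicity) of $f$ and $g$ respectively, in nonincreasing order. We say $g$ alternates left of $f$ (''$g$ alternates $f$'') if $\deg f=\deg g=n$ and $s_n\le r_n\le s_{n-1}\le\cdots\le s_2\le r_2\le s_1\le r_1$. We say $g$ interlaces $f$ if $\deg f=\deg g+1=n$ and $r_n\le s_{n-1}\le\cdots\le s_2\le r_2\le s_1\le r_1$. Write $g\preceq f$ for ''either $g$ alternates $f$ or $g$ interlaces $f$''. If no equality sign occurs in the respective chain of inequalities, $g$ strictly alternates (resp. strictly interlaces) $f$; write $g\prec f$ for ''either $g$ strictly alternates $f$ or $g$ strictly interlaces $f$''. By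 convention, $a\preceq bx+c$ for any real constants $a,b,c$, and $f\preceq 0$, $0\preceq f$ for any real polynomial $f$ with only real zeros. *)

(* Defs.v *)
From mathcomp Require Import all_boot all_order all_algebra.
From mathcomp Require Import reals constructive_ereal complex.

Set Implicit Arguments.
Unset Strict Implicit.
Unset Printing Implicit Defensive.

Import Order.TTheory GRing.Theory Num.Theory.
Local Open Scope ring_scope.

(* The zero polynomial has degree -oo, so that deg 0 + 1 = deg 0. *)
Definition deg (R : realType) (p : {poly R}) : \bar int :=
  if p == 0 then -oo%E else ((size p).-1%:Z)%:E.

Definition standard (R : realType) (p : {poly R}) : Prop :=
  p = 0 \/ 0 < lead_coef p.

(* Every complex zero is real.  The zero polynomial is counted as real-rooted,
   as the conventions on [preceq] below require. *)
Definition RZ (R : realType) (p : {poly R}) : Prop :=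
  p = 0 \/
  forall z : R[i], root (map_poly (real_complex R) p) z -> complex.Im z = 0.

(* [s] lists the real zeros of a nonzero [p], with multiplicity, in
   nonincreasing order; [s`_0] is the largest one. *)
Definition zeros (R : realType) (p : {poly R}) (s : seq R) : Prop :=
  sorted >=%R s /\ forall x : R, count_mem x s = mup x p.

(* The next two relations are parametrized by the comparison used in the chain:
   [<=%R] for the weak notions, [<%R] for the strict ones.  With r_(i+1) = r`_i
   and s_(i+1) = s`_i, the chain consists of s_i <= r_i and r_(i+1) <= s_i for
   all indices in range. *)
Definition alternates_by (R : realType) (cmp : rel R) (g f : {poly R}) : Prop :=
  [/\ RZ g, RZ f &
   exists (n : nat) (r s : seq R),
     [/\ deg g = (n%:Z)%:E /\ deg f = (n%:Z)%:E,
         zeros f r, zeros g s,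
         forall i : nat, (i < n)%N -> cmp s`_i r`_i &
         forall i : nat, (i.+1 < n)%N -> cmp r`_i.+1 s`_i]].

Definition interlaces_by (R : realType) (cmp : rel R) (g f : {poly R}) : Prop :=
  [/\ RZ g, RZ f &
   exists (n : nat) (r s : seq R),
     [/\ deg f = (deg g + 1)%E /\ deg f = (n%:Z)%:E,
         zeros f r, zeros g s,
         forall i : nat, (i.+1 < n)%N -> cmp s`_i r`_i &
         forall i : nat, (i.+1 < n)%N -> cmp r`_i.+1 s`_i]].

Definition preceq (R : realType) (g f : {poly R}) : Prop :=
  [\/ alternates_by <=%R g f \/ interlaces_by <=%R g f,
      exists a b c : R, g = a%:P /\ f = b *: 'X + c%:P,
      RZ g /\ f = 0 |
      g = 0 /\ RZ f].

Definition prec (R : realType) (g f : {poly R}) : Prop :=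
  alternates_by <%R g f \/ interlaces_by <%R g f.

Definition positive_constant (R : realType) (p : {poly R}) : Prop :=
  exists k : R, 0 < k /\ p = k%:P.

(* Main.v *)
(** Reduce to coprime f, g by dividing out their common zeros; this leaves
    all the hypotheses intact.  Then zeros are simple, and the signs of f at the
    zeros of g, and of g at the zeros of f, alternate.  If c = k > 0, then
    G = k f at the zeros of g; if d = k > 0, then G = k g at the zeros of f.
    Either way the intermediate value theorem and the degree bound locate all
    the zeros of G, which are real, simple and interlaced with those of g
    (resp. f).  At the zeros of G one has k F = - Delta g (resp. k F = Delta f),
    so the signs of F there alternate, up to vanishing.  After dividing F and G
    by their common zeros the alternation is strict, and the intermediate value
    theorem locates the zeros of F.

    Interlacing is expressed by counting zeros: the chain of inequalities
    amounts to N_g <= N_f <= N_g + 1, where N_p counts the zeros of p in an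
    arbitrary upward closed set.  In this form it is insensitive to common
    zeros, so no perturbation argument is needed for the weak case. *)

Require Import Defs.
From mathcomp Require Import all_boot all_order all_algebra.
From mathcomp Require Import reals constructive_ereal complex.
From mathcomp Require Import polyrcf ring zify.

Set Implicit Arguments.
Unset Strict Implicit.
Unset Printing Implicit Defensive.

Import Order.TTheory GRing.Theory Num.Theory.
Local Open Scope ring_scope.

Local Notation rootprod s := (\prod_(x <- s) ('X - x%:P)).

(* Beware that [(> x)] is the predicate [fun z => x < z], so that
   [count (> x) s] is the number of entries of [s] above [x]. *)

Definition upward_closed (R : realDomainType) (P : pred R) : Prop :=
  forall x y : R, x <= y -> P x -> P y.

(** The counts ignore the order of the entries, so lists need sorting only when translated to or
    from a chain. Taking [P] to be everything gives the two admissible degree differences, 0 and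
    1. *)
Definition interleave (R : realDomainType) (s r : seq R) : Prop :=
  forall P : pred R, upward_closed P ->
    (count P s <= count P r <= (count P s).+1)%N.

Lemma count_eq0 (T : eqType) (P : pred T) (s : seq T) :
  {in s, forall x, ~~ P x} -> count P s = 0%N.
Proof.
by move=> NP; apply/eqP; rewrite -leqn0 leqNgt -has_count; apply/hasPn.
Qed.

Lemma upward_closed_lt (R : realDomainType) (x : R) :
  upward_closed (> x).
Proof. by move=> y z yz /lt_le_trans; apply. Qed.

Lemma upward_closed_le (R : realDomainType) (x : R) :
  upward_closed (>= x).
Proof. by move=> y z yz /le_trans; apply. Qed.

Lemma interleave_perm (R : realDomainType) (s s' r r' : seq R) :
  perm_eq s s' -> perm_eq r r' -> interleave s r -> interleave s' r'.
Proof. by move=> /permP ss' /permP rr' I P /I; rewrite ss' rr'. Qed.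

Lemma interleave_cat (R : realDomainType) (h s r : seq R) :
  interleave (h ++ s) (h ++ r) <-> interleave s r.
Proof. by split=> I P /I; rewrite !count_cat -addnS !leq_add2l. Qed.

Lemma interleave_cons (R : realDomainType) (x : R) (s r : seq R) :
  interleave (x :: s) (x :: r) <-> interleave s r.
Proof. exact: (@interleave_cat R [:: x]). Qed.

Lemma interleave_size (R : realDomainType) (s r : seq R) :
  interleave s r -> (size s <= size r <= (size s).+1)%N.
Proof. by move=> /(_ predT); rewrite !count_predT; apply. Qed.

(** Cancelling an entry present in both lists lowers both counts equally, so it can be repeated
    until the lists are disjoint. The list [h] becomes the zeros of the common factor. *)
Lemma interleave_common (R : realDomainType) (s r : seq R) :
  interleave s r ->
  exists h s' r' : seq R, [/\ perm_eq s (h ++ s'), perm_eq r (h ++ r'),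
    ~~ has (mem r') s' & interleave s' r'].
Proof.
elim: {s}(size s) {-2}s (erefl (size s)) r => [|n IHn] s sn r I.
  by move: I; rewrite (size0nil sn); exists [::], [::], r.
have [/hasP[x xs xr]|Nsr] := boolP (has (mem r) s); last by exists [::], s, r.
have ps := perm_to_rem xs; have pr := perm_to_rem xr.
have rs : size (rem x s) = n by rewrite size_rem // sn.
have /interleave_cons/(IHn _ rs) := interleave_perm ps pr I.
case=> h [s' [r' [ps' pr' N I']]].
exists (x :: h), s', r'; split=> //.
  by rewrite (permPl ps) perm_cons.
by rewrite (permPl pr) perm_cons.
Qed.

Lemma count_upward (R : realDomainType) (P : pred R) (s r : seq R) :
  upward_closed P -> (size s <= size r)%N ->
  (forall i, (i < size s)%N -> s`_i <= r`_i) -> (count P s <= count P r)%N.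
Proof.
move=> uP; elim: s r => [|x s IHs] [|y r] //= sr le_sr.
apply: leq_add; last by apply: IHs => // i; exact: le_sr i.+1.
by have := uP _ _ (le_sr 0 isT); case: (P x) => //= ->.
Qed.

(** Termwise domination bounds counts on upward closed sets: [s] is dominated by [r], and the tail
    of [r] by [s]. The head of [r] costs at most one. *)
Lemma interleave_of_nth (R : realDomainType) (s r : seq R) :
  (size s <= size r <= (size s).+1)%N ->
  (forall i, (i < size s)%N -> s`_i <= r`_i) ->
  (forall i, (i.+1 < size r)%N -> r`_i.+1 <= s`_i) -> interleave s r.
Proof.
move=> /andP[sr rs] le_sr le_rs P uP; rewrite count_upward //=.
case: r sr rs {le_sr} le_rs => [|y r] //= _ rs le_rs.
by rewrite -add1n leq_add ?leq_b1 // count_upward.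
Qed.

(** In a nonincreasing list the entries in an upward closed set form an initial segment. *)
Lemma sorted_count_upward (R : realDomainType) (P : pred R) (s : seq R) i :
  upward_closed P -> sorted >=%R s -> (i < size s)%N ->
  P s`_i = (i < count P s)%N.
Proof.
move=> uP; elim: s i => [|x s IHs] // i xs.
have xs' : all (<= x)%R s by apply: order_path_min xs; exact: ge_trans.
have ss := path_sorted xs.
have [Px|NPx] := boolP (P x).
  by case: i => [|i] /=; rewrite Px //= add1n ltnS; apply: IHs.
have NPs : all (predC P) s.
  by apply: sub_all xs' => y yx; apply: contra NPx; apply: uP.
rewrite /= (negbTE NPx) add0n.
have -> : count P s = 0%N by apply: count_eq0; apply/allP.
by case: i => [|i] /= si; [exact: negbTE | exact/negbTE/(all_nthP _ NPs)].
Qed.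

(** Test the counts on the closed rays starting at [s]_i[and at]r[_i.+1]. *)
Lemma nth_of_interleave (R : realDomainType) (s r : seq R) :
  sorted >=%R s -> sorted >=%R r -> interleave s r ->
  (forall i, (i < size s)%N -> s`_i <= r`_i) /\
  (forall i, (i.+1 < size r)%N -> r`_i.+1 <= s`_i).
Proof.
move=> ss sr I; have /andP[zsr zrs] := interleave_size I.
have le_up := @upward_closed_le R.
split=> i lt_i.
  have /andP[I1 _] := I _ (le_up s`_i).
  rewrite (sorted_count_upward (le_up _) sr); last exact: leq_trans zsr.
  by apply: leq_trans I1; rewrite -(sorted_count_upward (le_up _) ss).
have /andP[_ I2] := I _ (le_up r`_i.+1).
have lt_s : (i < size s)%N by rewrite -ltnS; exact: leq_trans zrs.
rewrite (sorted_count_upward (le_up _) ss) // -ltnS.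
by apply: leq_trans I2; rewrite -(sorted_count_upward (le_up _) sr).
Qed.

Lemma count_le_lt (R : realDomainType) (x : R) (s : seq R) :
  (count (>= x)%R s = count_mem x s + count (> x)%R s)%N.
Proof.
elim: s => //= y s ->; rewrite [x <= y]le_eqVlt eq_sym.
case: eqP => [->|_] /=; rewrite ?ltxx ?add0n.
  by rewrite addnA.
by rewrite addnCA.
Qed.

(** Compare the open and the closed ray at [x]: the count of [s] stays put while that of [r] grows
    by the multiplicity of [x]. A slack of one forces multiplicity one and equality before the jump.
    This yields both simplicity of zeros and alternation of signs. *)
Lemma interleave_count_r (R : realDomainType) (s r : seq R) (x : R) :
  interleave s r -> x \in r -> x \notin s ->
  count_mem x r = 1%N /\ count (> x) s = count (> x) r.
Proof.
move=> I; rewrite -has_pred1 has_count => xr /count_memPn xs.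
have := I _ (@upward_closed_lt R x); have := I _ (@upward_closed_le R x).
rewrite !count_le_lt xs.
by move: (count (> x) s) (count (> x) r) (count_mem x r) xr => m n k; lia.
Qed.

Lemma interleave_count_l (R : realDomainType) (s r : seq R) (x : R) :
  interleave s r -> x \in s -> x \notin r ->
  count_mem x s = 1%N /\ count (> x) r = (count (> x) s).+1.
Proof.
move=> I; rewrite -has_pred1 has_count => xs /count_memPn xr.
have := I _ (@upward_closed_lt R x); have := I _ (@upward_closed_le R x).
rewrite !count_le_lt xr.
by move: (count (> x) s) (count (> x) r) (count_mem x s) xs => m n k; lia.
Qed.

Lemma uniq_of_count (T : eqType) (s : seq T) :
  (forall x, x \in s -> count_mem x s = 1%N) -> uniq s.
Proof.
move=> s1; apply: count_mem_uniq => x.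
by have [/s1|/count_memPn] := boolP (x \in s).
Qed.

(** * Locating zeros from signs at given points *)

Lemma sign_horner_roots (R : realDomainType) (s : seq R) (x : R) :
  x \notin s ->
  0 < (-1) ^+ count (> x) s * (rootprod s).[x].
Proof.
elim: s => [|y s IHs]; first by rewrite big_nil hornerC expr0 mulr1.
rewrite inE negb_or big_cons => /andP[xy /IHs h].
rewrite hornerM hornerXsubC /=.
move: xy; rewrite neq_lt => /orP[xy|yx].
  rewrite xy add1n exprS mulN1r mulNr mulrCA -mulNr opprB.
  by rewrite mulr_gt0 ?subr_gt0.
by rewrite (lt_gtF yx) add0n mulrCA mulr_gt0 ?subr_gt0.
Qed.

(** Substituting -x and correcting the sign reduces this to the behaviour at +oo. *)
Lemma sign_horner_ninfty (R : realFieldType) (p : {poly R}) :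
  0 < lead_coef p ->
  exists m : R, forall x, x <= m -> 0 < (-1) ^+ (size p).-1 * p.[x].
Proof.
move=> lp; pose q := (-1) ^+ (size p).-1 *: (p \Po - 'X).
have sX : (size (- 'X : {poly R}) = 2)%N by rewrite size_polyN size_polyX.
have lq : lead_coef q = lead_coef p.
  rewrite lead_coefZ lead_coef_comp ?sX // lead_coefN lead_coefX.
  by rewrite mulrCA -exprMn mulrNN mulr1 expr1n mulr1.
have [|n qn] := @poly_pinfty_gt_lc R q; first by rewrite lq.
exists (- n) => x; rewrite lerNr => /qn.
by rewrite lq hornerZ horner_comp !hornerE opprK; apply: lt_le_trans.
Qed.

Lemma sign_change (R : realDomainType) (n : nat) (u v : R) :
  0 < (-1) ^+ n * u -> 0 < (-1) ^+ n.+1 * v -> u * v < 0.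
Proof.
rewrite exprS mulN1r mulNr => u0 v0; have := mulr_gt0 u0 v0.
by rewrite mulrN oppr_gt0 mulrACA -expr2 sqrr_sign mul1r.
Qed.

(** Each gap between consecutive points contains a zero. The lists [xs] and [belast x0 xs] are the
    lower and the upper ends of the gaps, whence the two bounds on counts. *)
Lemma ivt_chain (R : rcfType) (q : {poly R}) (x0 : R) (xs : seq R) :
  path >%R x0 xs -> path (fun u v => q.[u] * q.[v] < 0) x0 xs ->
  exists ys : seq R, [/\ size ys = size xs, all (root q) ys, path >%R x0 ys &
    forall P : pred R, upward_closed P ->
      (count P xs <= count P ys <= count P (belast x0 xs))%N].
Proof.
elim: xs x0 => [|x1 xs IHxs] x0 /=; first by exists [::].
move=> /andP[x10 pxs] /andP[q01 /(IHxs _ pxs)[ys [sys rys pys cys]]].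
have [|y] := poly_ivtoo (ltW x10) (_ : q.[x1] * q.[x0] < 0).
  by rewrite mulrC.
rewrite in_itv /= => /andP[x1y yx0] ry; exists (y :: ys); split=> //=.
- by rewrite sys.
- by rewrite ry rys.
- rewrite yx0 /=; case: ys pys {sys rys cys} => //= z ys /andP[zx1 ->].
  by rewrite andbT (lt_trans zx1).
move=> P uP; have /andP[c1 c2] := cys P uP.
have h1 := uP _ _ (ltW yx0); have h2 := uP _ _ (ltW x1y).
apply/andP; split; apply: leq_add => //.
  by case: (P x1) h2 => // ->.
by case: (P y) h1 => // ->.
Qed.

(** The offset [k] is for the induction: dropping the largest point lowers every remaining count by
    one. The sign at the last point serves to find a further zero below it. *)
Lemma alternating_path (R : realDomainType) (q : {poly R}) (k : nat) (x0 : R)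
    (xs : seq R) :
  path >%R x0 xs ->
  (forall x, x \in x0 :: xs ->
     0 < (-1) ^+ (k + count (> x) (x0 :: xs)) * q.[x]) ->
  path (fun u v => q.[u] * q.[v] < 0) x0 xs /\
  0 < (-1) ^+ (k + size xs) * q.[last x0 xs].
Proof.
elim: xs k x0 => [|x1 xs IHxs] k x0 /=.
  by move=> _ /(_ x0 (mem_head _ _)); rewrite /= ltxx.
move=> /andP[x10 pxs] h.
have lt_x0 x : x \in x1 :: xs -> x < x0.
  rewrite inE => /predU1P[->//|xxs]; apply: lt_trans x10.
  have /allP := order_path_min (rev_trans lt_trans) pxs; exact.
have [|p1 p2] := IHxs k.+1 x1 pxs.
  move=> x xx; have := h x; rewrite inE xx orbT => /(_ isT).
  by rewrite (lt_x0 _ xx) add1n addnS -addSn.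
split; last by rewrite -addSnnS.
rewrite p1 andbT.
have := h x0 (mem_head _ _); have := h x1; rewrite !inE eqxx orbT => /(_ isT).
rewrite x10 ltxx [x0 < x1]ltNge (ltW x10) /=.
have -> : count (> x1) xs = 0%N.
  apply: count_eq0 => z zxs; rewrite -leNgt ltW //.
  have /allP := order_path_min (rev_trans lt_trans) pxs; exact.
have -> : count (> x0) xs = 0%N.
  by apply: count_eq0 => z zxs; rewrite -leNgt ltW // lt_x0 // inE zxs orbT.
by rewrite ltxx /= !addn0 addn1 => h1 h0; exact: sign_change h0 h1.
Qed.

(** The gaps supply one zero fewer than there are points, and the size bound leaves room for at most
    one more. The zeros found therefore exhaust the degree, and [q] splits. *)
Lemma alternating_roots (R : rcfType) (q : {poly R}) (pts : seq R) :
  0 < lead_coef q -> uniq pts -> (size q <= (size pts).+1)%N ->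
  (forall x, x \in pts -> 0 < (-1) ^+ count (> x) pts * q.[x]) ->
  exists ys : seq R,
    q = lead_coef q *: rootprod ys /\ interleave ys pts.
Proof.
move=> lq; wlog sp : pts / sorted >%R pts => [wlog_sorted|] up szq h.
  have pp : perm_eq (sort >=%R pts) pts by rewrite perm_sort.
  have [||||ys [qE I]] := wlog_sorted (sort >=%R pts).
  - rewrite (@lt_sorted_uniq_le _ R^d) sort_uniq up /=.
    by apply: sort_sorted => x y; exact: le_total.
  - by rewrite sort_uniq.
  - by rewrite size_sort.
  - by move=> x; rewrite mem_sort => /h; rewrite (permP pp).
  by exists ys; split=> //; exact: (interleave_perm (perm_refl _) pp I).
have q0 : q != 0 by rewrite -lead_coef_eq0 gt_eqF.
case: pts sp up szq h => [|x0 xs] sp up szq h.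
  exists [::]; split=> //; rewrite big_nil.
  have /size1_polyC qE : (size q <= 1)%N by [].
  by rewrite {1}qE {1}[in RHS]qE lead_coefC -mul_polyC mulr1.
have [alt sgn_last] := @alternating_path _ q 0 x0 xs sp h.
have path_uniq (ys : seq R) : path >%R x0 ys -> uniq ys.
  by move/path_sorted; apply: (sorted_uniq (rev_trans lt_trans) ltxx).
have qE (ys : seq R) : size q = (size ys).+1 -> all (root q) ys ->
    path >%R x0 ys -> q = lead_coef q *: rootprod ys.
  move=> sz rys /path_uniq uys; apply: all_roots_prod_XsubC => //.
  by rewrite uniq_rootsE.
have [szq'|szq'] := leqP (size q) (size xs).+1.
  have [ys [sys rys pys cys]] := ivt_chain sp alt.
  have szys := max_poly_roots q0 rys (path_uniq ys pys).
  exists ys; split.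
    by apply: qE => //; apply/eqP; rewrite eqn_leq szys andbT sys.
  move=> P uP; have := cys P uP.
  (* Leaving out the largest or the smallest point changes a count by at most one. *)
  have : count P (rcons (belast x0 xs) (last x0 xs)) = count P (x0 :: xs).
    by rewrite -lastI.
  rewrite -cats1 count_cat /=.
  by case: (P x0); case: (P (last x0 xs)) => /=; lia.
(* One more zero lies below the last point: add a point near -oo. *)
have [m0 hm0] := sign_horner_ninfty lq.
pose m := Num.min m0 (last x0 xs - 1).
have m_last : m < last x0 xs by rewrite gt_min ltrBlDr ltrDl ltr01 orbT.
have sgn_m : 0 < (-1) ^+ (size q).-1 * q.[m] by apply: hm0; rewrite ge_min lexx.
have szq2 : size q = (size xs).+2 by apply/eqP; rewrite eqn_leq szq szq'.
have sp' : path >%R x0 (rcons xs m) by rewrite rcons_path (sp : path _ _ _).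
have alt' : path (fun u v => q.[u] * q.[v] < 0) x0 (rcons xs m).
  rewrite rcons_path alt /=; move: sgn_m; rewrite szq2 /=.
  exact: sign_change sgn_last.
have [ys [sys rys pys cys]] := ivt_chain sp' alt'.
exists ys; split; first by apply: qE => //; rewrite sys size_rcons.
move=> P uP; have := cys P uP; rewrite belast_rcons -cats1 count_cat /=.
by case: (P x0) => /=; lia.
Qed.

Lemma strict_upper_bound (R : realDomainType) (n : R) (s : seq R) :
  exists2 M : R, n <= M & forall x, x \in s -> x < M.
Proof.
elim: s => [|y s [M nM sM]]; first by exists n.
exists (Num.max M (y + 1)); first by rewrite le_max nM.
move=> x; rewrite inE lt_max => /predU1P[->|/sM->//].
by rewrite ltrDl ltr01 orbT.
Qed.

Lemma split_root (R : idomainType) (p : {poly R}) (s : seq R) (x : R) :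
  p != 0 -> p = lead_coef p *: rootprod s -> (p.[x] == 0) = (x \in s).
Proof.
move=> p0 pE; rewrite -[_ == 0]/(root p x) {1}pE.
by rewrite rootZ ?lead_coef_eq0 // root_prod_XsubC.
Qed.

Lemma split_size (R : idomainType) (p : {poly R}) (s : seq R) :
  p != 0 -> p = lead_coef p *: rootprod s -> size p = (size s).+1.
Proof.
by move=> p0 pE; rewrite {1}pE size_scale ?lead_coef_eq0 // size_prod_XsubC.
Qed.

Lemma lead_coef_gt0_neq0 (R : numDomainType) (p : {poly R}) :
  0 < lead_coef p -> p != 0.
Proof. by rewrite -lead_coef_eq0 => /lt0r_neq0. Qed.

(** Adjoining a point above all of [s], where [q] is positive, raises every count on [s] by one and
    so reverses the required signs: [alternating_roots] applies. *)
Lemma interleave_of_sign_lt (R : rcfType) (q : {poly R}) (s : seq R) :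
  0 < lead_coef q -> uniq s -> (size q <= (size s).+2)%N ->
  (forall x, x \in s -> (-1) ^+ count (> x) s * q.[x] < 0) ->
  exists ys : seq R, q = lead_coef q *: rootprod ys /\ interleave s ys.
Proof.
move=> lq us szq sgn; have [n hn] := poly_pinfty_gt_lc lq.
have [M nM sM] := strict_upper_bound n s.
have NsM : M \notin s by apply/negP => /sM; rewrite ltxx.
(* M stands for +oo. *)
have [|||ys [qE I]] := @alternating_roots R q (M :: s) lq.
- by rewrite /= NsM.
- by [].
- move=> x; rewrite inE => /predU1P[->|xs] /=.
    have -> : count (> M) s = 0%N.
      by apply: count_eq0 => z /sM zM; rewrite -leNgt ltW.
    by rewrite ltxx mul1r (lt_le_trans lq) ?hn.
  by rewrite sM // add1n exprS mulN1r mulNr oppr_gt0 sgn.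
exists ys; split=> // P uP; have := I P uP => /=.
(* If [P] contains [M], the extra point accounts for the shift by one. Otherwise [P] misses all of
   [s] too, and both counts are 0. *)
have [PM|NPM] := boolP (P M); first by case: (count P ys) => [|m]; lia.
have P0 (z : R) : z <= M -> P z = false.
  by move=> zM; apply/negP => /(uP _ _ zM); apply/negP.
have -> : count P s = 0%N.
  by apply: count_eq0 => z /sM/ltW zM; rewrite P0.
lia.
Qed.

(** Points of [s] where [q] vanishes are divided out one at a time. Dividing by ['X - x%:P] flips
    the sign exactly at the points below [x], which are those whose count drops when [x] leaves [s].
    What remains has strict signs. *)
Lemma interleave_of_sign_le (R : rcfType) (q : {poly R}) (s : seq R) :
  0 < lead_coef q -> uniq s -> (size q <= (size s).+2)%N ->
  (forall x, x \in s -> (-1) ^+ count (> x) s * q.[x] <= 0) ->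
  exists ys : seq R, q = lead_coef q *: rootprod ys /\ interleave s ys.
Proof.
elim: {s}(size s) {-2}s (erefl (size s)) q => [|n IHn] s sn q lq us szq sgn.
  apply: interleave_of_sign_lt => //.
  by rewrite (size0nil sn).
have [/hasP[x xs rx]|Nqs] := boolP (has (root q) s); last first.
  apply: interleave_of_sign_lt => //.
  move=> x xs; rewrite lt_neqAle sgn // andbT mulf_neq0 ?signr_eq0 //.
  by apply: contra Nqs => qx; apply/hasP; exists x.
have ps := perm_to_rem xs.
have rs : size (rem x s) = n by rewrite size_rem // sn.
have /factor_theorem[q2 qE] := rx.
have lqE : lead_coef q = lead_coef q2.
  by rewrite qE lead_coef_Mmonic ?monicXsubC.
have q20 : q2 != 0 by rewrite -lead_coef_eq0 -lqE gt_eqF.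
have [||||ys [q2E I]] := IHn _ rs q2.
- by rewrite -lqE.
- exact: rem_uniq.
- by move: szq; rewrite rs sn qE size_Mmonic ?monicXsubC // size_XsubC addn2.
- move=> z zs; have := sgn z (mem_rem zs).
  have zx : z != x.
    by apply: contraL zs => /eqP->; rewrite mem_rem_uniq // inE eqxx.
  rewrite (permP ps) qE hornerM hornerXsubC /=.
  move: zx; rewrite neq_lt => /orP[zx|xz].
    rewrite zx add1n exprS mulN1r mulNr -mulrN -mulrN opprB mulrA.
    by rewrite pmulr_lle0 ?subr_gt0.
  by rewrite (lt_gtF xz) add0n mulrA pmulr_lle0 ?subr_gt0.
exists (x :: ys); split; last first.
  have pss : perm_eq (x :: rem x s) s by rewrite perm_sym.
  by apply: (interleave_perm pss (perm_refl _)); apply/interleave_cons.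
by rewrite big_cons lqE scalerAr -q2E mulrC.
Qed.

(** * From the signs of f and g to the zeros of G and F *)

Section Transfer.

Variables (R : rcfType) (f g F G a b c d : {poly R}) (k : R).
Hypotheses (FE : F = a * f + b * g) (GE : G = c * f + d * g).
Hypotheses (lF : 0 < lead_coef F) (lG : 0 < lead_coef G).
Hypotheses (szF : (size F <= (size G).+1)%N) (k_gt0 : 0 < k).
Hypothesis Delta_ge0 : forall x, G.[x] = 0 -> 0 <= (a * d - b * c).[x].

(** Only the signs of [f] on [s] enter, so [f] may be zero when [s] is empty. Here [G] may have one
    zero more than [g], hence the criterion with a point near +oo. *)
Lemma interleave_const_c (s : seq R) :
  c = k%:P -> 0 < lead_coef g -> g = lead_coef g *: rootprod s -> uniq s ->
  (forall x, x \in s -> (-1) ^+ count (> x) s * f.[x] < 0) ->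
  (size G <= (size g).+1)%N ->
  exists t y : seq R, [/\ G = lead_coef G *: rootprod t,
    F = lead_coef F *: rootprod y & interleave t y].
Proof.
move=> cE lg gE us sgn szG.
have g0 x : (g.[x] == 0) = (x \in s).
  exact: (split_root _ (lead_coef_gt0_neq0 lg)).
have Gs x : x \in s -> G.[x] = k * f.[x].
  by rewrite -g0 GE cE !hornerE /= => /eqP->; rewrite mulr0 addr0.
have [||t [tE I]] := interleave_of_sign_lt lG us.
- by apply: leq_trans szG _; rewrite (split_size _ gE) ?lead_coef_gt0_neq0.
- by move=> x xs; rewrite Gs // mulrCA pmulr_rlt0 // sgn.
have G0 x : (G.[x] == 0) = (x \in t).
  exact: (split_root _ (lead_coef_gt0_neq0 lG)).
have ts x : x \in t -> x \notin s.
  rewrite -G0; apply: contraL => xs; rewrite Gs // mulf_eq0 (gt_eqF k_gt0) /=.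
  by apply: contraTneq (sgn x xs) => ->; rewrite mulr0 ltxx.
have ut : uniq t.
  by apply: uniq_of_count => x xt; have [] := interleave_count_r I xt (ts _ xt).
have [||y [yE Iy]] := interleave_of_sign_le lF ut; last by exists t, y.
  by apply: leq_trans szF _; rewrite (split_size _ tE) ?lead_coef_gt0_neq0.
(* Passing from the count over [t] to the equal count over [s] makes the sign of [g] available. *)
move=> x xt; have [_ <-] := interleave_count_r I xt (ts _ xt).
have Gx : G.[x] = 0 by apply/eqP; rewrite G0.
have gx : 0 < (-1) ^+ count (> x) s * g.[x].
  by rewrite gE hornerZ mulrCA mulr_gt0 ?sign_horner_roots ?ts.
have D := Delta_ge0 Gx.
rewrite -(pmulr_rle0 _ k_gt0) mulrCA.
have -> : k * F.[x] = - ((a * d - b * c).[x] * g.[x]).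
  move: Gx; rewrite GE FE cE !hornerE /= => Gx.
  have kf : k * f.[x] = - (d.[x] * g.[x]) by apply/eqP; rewrite -addr_eq0 Gx.
  by ring: kf.
by rewrite mulrN mulrCA oppr_le0 mulr_ge0 // ltW.
Qed.

(** Here [G] has no more zeros than [f], so [alternating_roots] applies directly. Now [t] lies to
    the left of [r], and the counts at a zero of [G] differ by one; this makes up for the opposite
    sign in k F = Delta f. *)
Lemma interleave_const_d (r : seq R) :
  d = k%:P -> 0 < lead_coef f -> f = lead_coef f *: rootprod r -> uniq r ->
  (forall x, x \in r -> 0 < (-1) ^+ count (> x) r * g.[x]) ->
  (size G <= size f)%N ->
  exists t y : seq R, [/\ G = lead_coef G *: rootprod t,
    F = lead_coef F *: rootprod y & interleave t y].
Proof.
move=> dE lf fE ur sgn szG.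
have f0 x : (f.[x] == 0) = (x \in r).
  exact: (split_root _ (lead_coef_gt0_neq0 lf)).
have Gr x : x \in r -> G.[x] = k * g.[x].
  by rewrite -f0 GE dE !hornerE /= => /eqP->; rewrite mulr0 add0r.
have [||t [tE I]] := alternating_roots lG ur.
- by apply: leq_trans szG _; rewrite (split_size _ fE) ?lead_coef_gt0_neq0.
- by move=> x xr; rewrite Gr // mulrCA pmulr_rgt0 // sgn.
have G0 x : (G.[x] == 0) = (x \in t).
  exact: (split_root _ (lead_coef_gt0_neq0 lG)).
have tr x : x \in t -> x \notin r.
  rewrite -G0; apply: contraL => xr; rewrite Gr // mulf_eq0 (gt_eqF k_gt0) /=.
  by apply: contraTneq (sgn x xr) => ->; rewrite mulr0 ltxx.
have ut : uniq t.
  by apply: uniq_of_count => x xt; have [] := interleave_count_l I xt (tr _ xt).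
have [||y [yE Iy]] := interleave_of_sign_le lF ut; last by exists t, y.
  by apply: leq_trans szF _; rewrite (split_size _ tE) ?lead_coef_gt0_neq0.
move=> x xt; have [_ cr] := interleave_count_l I xt (tr _ xt).
have Gx : G.[x] = 0 by apply/eqP; rewrite G0.
have fx : 0 < (-1) ^+ count (> x) r * f.[x].
  by rewrite fE hornerZ mulrCA mulr_gt0 ?sign_horner_roots ?tr.
have D := Delta_ge0 Gx.
rewrite -(pmulr_rle0 _ k_gt0) mulrCA.
have -> : k * F.[x] = (a * d - b * c).[x] * f.[x].
  move: Gx; rewrite GE FE dE !hornerE /= => Gx.
  have kg : k * g.[x] = - (c.[x] * f.[x]).
    by apply/eqP; rewrite -addr_eq0 addrC Gx.
  by ring: kg.
rewrite mulrCA mulr_ge0_le0 // ltW //.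
by move: fx; rewrite cr exprS mulN1r mulNr oppr_gt0.
Qed.

End Transfer.

(** * Real-rooted polynomials as products, and chains as counts *)

(** Factor over the complex numbers; all roots equal their real parts, and the factorization
    descends because the embedding of polynomials is injective. *)
Lemma RZ_split (R : realType) (p : {poly R}) :
  RZ p -> exists s : seq R, p = lead_coef p *: rootprod s.
Proof.
case=> [->|rz]; first by exists [::]; rewrite lead_coef0 scale0r.
have [->|p0] := eqVneq p 0; first by exists [::]; rewrite lead_coef0 scale0r.
have [zs zsE] := closed_field_poly_normal (map_poly (real_complex R) p).
exists (map (@complex.Re R) zs); apply: (map_poly_inj (real_complex R)).
rewrite zsE map_polyZ lead_coef_map rmorph_prod big_map; congr (_ *: _).
rewrite big_seq [RHS]big_seq; apply: eq_bigr => z zzs.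
rewrite rmorphB /= map_polyX map_polyC /=; congr (_ - _%:P).
have : complex.Im z = 0.
  apply: rz; rewrite zsE rootZ ?lead_coef_eq0 ?map_poly_eq0 //.
  by rewrite root_prod_XsubC.
by case: z {zzs} => u v /= ->.
Qed.

Lemma split_RZ (R : realType) (p : {poly R}) (s : seq R) :
  p = lead_coef p *: rootprod s -> RZ p.
Proof.
move=> pE; have [->|p0] := eqVneq p 0; [by left | right => z].
rewrite pE map_polyZ rootZ ?fmorph_eq0 ?lead_coef_eq0 //.
rewrite rmorph_prod /=.
under eq_bigr do rewrite rmorphB /= map_polyX map_polyC /=.
rewrite -(big_map (real_complex R) xpredT (fun w => 'X - w%:P)).
by rewrite root_prod_XsubC => /mapP[x _ ->].
Qed.

(** [zeros] sees real zeros only; that they exhaust the degree comes from [RZ], through a list with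
    the same multiplicities. *)
Lemma zeros_split (R : realType) (p : {poly R}) (s : seq R) :
  RZ p -> p != 0 -> zeros p s -> p = lead_coef p *: rootprod s.
Proof.
move=> /RZ_split[s' pE] p0 [_ cs]; rewrite {1}pE; congr (_ *: _).
apply: perm_big; apply/allP => x _ /=; rewrite cs pE.
rewrite -mul_polyC mupMr ?mu_prod_XsubC //.
by rewrite rootC lead_coef_eq0.
Qed.

Lemma split_zeros (R : realType) (p : {poly R}) (s : seq R) :
  p != 0 -> p = lead_coef p *: rootprod s -> zeros p (sort >=%R s).
Proof.
move=> p0 pE; split; first by apply: sort_sorted => x y; exact: le_total.
move=> x; rewrite pE -mul_polyC mupMr ?mu_prod_XsubC.
  by apply/permP; rewrite perm_sort.
by rewrite rootC lead_coef_eq0.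
Qed.

Lemma deg_neq0 (R : realType) (p : {poly R}) :
  p != 0 -> deg p = ((size p).-1%:Z)%:E.
Proof. by move=> /negbTE p0; rewrite /deg p0. Qed.

Lemma deg_split (R : realType) (p : {poly R}) (s : seq R) :
  p != 0 -> p = lead_coef p *: rootprod s -> deg p = ((size s)%:Z)%:E.
Proof. by move=> p0 pE; rewrite deg_neq0 // (split_size p0 pE). Qed.

Lemma deg_nat_neq0 (R : realType) (p : {poly R}) (n : nat) :
  deg p = (n%:Z)%:E -> p != 0.
Proof. by rewrite /deg; case: eqP. Qed.

(** Alternation and interlacing become a single chain, distinguished only by the lengths of the
    lists. *)
Lemma chain_of_by (R : realType) (cmp : rel R) (g f : {poly R}) :
  alternates_by cmp g f \/ interlaces_by cmp g f ->
  exists s r : seq R, [/\ f != 0, g != 0,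
    g = lead_coef g *: rootprod s, f = lead_coef f *: rootprod r &
    [/\ sorted >=%R s, sorted >=%R r,
      (size s <= size r <= (size s).+1)%N,
      forall i, (i < size s)%N -> cmp s`_i r`_i &
      forall i, (i.+1 < size r)%N -> cmp r`_i.+1 s`_i]].
Proof.
case=> -[gRZ fRZ [n [r [s [[d1 d2] zr zs c1 c2]]]]].
  have g0 := deg_nat_neq0 d1; have f0 := deg_nat_neq0 d2.
  have gE := zeros_split gRZ g0 zs; have fE := zeros_split fRZ f0 zr.
  move: d1 d2; rewrite (deg_split g0 gE) (deg_split f0 fE) => -[sn] [rn].
  exists s, r; split=> //; rewrite sn rn leqnn leqnSn.
  by split=> //; [exact: zs.1 | exact: zr.1].
have f0 := deg_nat_neq0 d2.
(* For [g] zero, [deg g + 1] would be -oo, whereas [deg f] is finite. *)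
have g0 : g != 0 by move: d1; rewrite d2 /deg; case: eqP.
have gE := zeros_split gRZ g0 zs; have fE := zeros_split fRZ f0 zr.
move: d1; rewrite d2 (deg_split g0 gE); move: d2; rewrite (deg_split f0 fE).
move=> -[rn] []; rewrite addn1 => sn.
exists s, r; split=> //; rewrite rn sn leqnn leqnSn.
split=> //; [exact: zs.1 | exact: zr.1 | | by rewrite -sn].
by move=> i si; apply: c1; rewrite sn.
Qed.

(** The last hypothesis upgrades the weak inequalities to [cmp]. It is trivial for [<=%R], and for
    [<%R] it follows from the absence of common zeros. *)
Lemma by_of_interleave (R : realType) (cmp : rel R) (g f : {poly R})
    (s r : seq R) :
  g != 0 -> f != 0 -> g = lead_coef g *: rootprod s ->
  f = lead_coef f *: rootprod r -> interleave s r ->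
  (forall x y, x \in s -> y \in r ->
     (x <= y -> cmp x y) /\ (y <= x -> cmp y x)) ->
  alternates_by cmp g f \/ interlaces_by cmp g f.
Proof.
move=> g0 f0 gE fE I cmpP.
have := split_zeros g0 gE; have := split_zeros f0 fE.
set r' := sort _ r; set s' := sort _ s => zr zs.
have ps : perm_eq s s' by rewrite perm_sym perm_sort.
have pr : perm_eq r r' by rewrite perm_sym perm_sort.
have I' := interleave_perm ps pr I.
have [c1 c2] := nth_of_interleave zs.1 zr.1 I'.
have /andP[zsr zrs] := interleave_size I.
have sr' : (size s' <= size r')%N by rewrite !size_sort.
have rs' : (size r' <= (size s').+1)%N by rewrite !size_sort.
have d1 i : (i < size s')%N -> cmp s'`_i r'`_i.
  move=> si; have [] := cmpP s'`_i r'`_i; last by move=> h _; exact/h/c1.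
    by rewrite (perm_mem ps) mem_nth.
  by rewrite (perm_mem pr) mem_nth // (leq_trans si).
have d2 i : (i.+1 < size r')%N -> cmp r'`_i.+1 s'`_i.
  move=> ri; have [] := cmpP s'`_i r'`_i.+1; last by move=> _ h; exact/h/c2.
    by rewrite (perm_mem ps) mem_nth // -ltnS (leq_trans ri).
  by rewrite (perm_mem pr) mem_nth.
have [gRZ fRZ] := (split_RZ gE, split_RZ fE).
have [szE|szN] := eqVneq (size r) (size s).
  left; split=> //; exists (size s), r', s'.
  rewrite (deg_split g0 gE) (deg_split f0 fE) szE; split=> // i si.
    by apply: d1; rewrite size_sort.
  by apply: d2; rewrite size_sort szE.
have szE : size r = (size s).+1.
  by apply/eqP; rewrite eqn_leq zrs ltn_neqAle eq_sym szN.
right; split=> //; exists (size r), r', s'.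
rewrite (deg_split g0 gE) (deg_split f0 fE); split=> //.
- by rewrite szE -addn1 PoszD.
- by move=> i si; apply: d1; rewrite size_sort -ltnS -szE.
- by move=> i si; apply: d2; rewrite size_sort.
Qed.

(** Suppose s_i = r_j. If j <= i then s_i < r_i <= r_j; otherwise r_j <= r_(i+1) < s_i. *)
Lemma prec_no_common_root (R : realType) (g f : {poly R}) (x : R) :
  prec g f -> g.[x] = 0 -> f.[x] <> 0.
Proof.
move=> /chain_of_by[s [r [f0 g0 gE fE [ss sr /andP[zsr zrs] c1 c2]]]].
move=> /eqP; rewrite (split_root x g0 gE) => /(nthP 0)[i si xi].
move=> /eqP; rewrite (split_root x f0 fE) => /(nthP 0)[j rj xj].
have le_r k l : (k <= l)%N -> (l < size r)%N -> r`_l <= r`_k.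
  move=> kl lr; apply: (sorted_leq_nth ge_trans lexx 0 sr) => //.
  exact: leq_ltn_trans lr.
have [ji|ij] := leqP j i.
  have ir : (i < size r)%N by exact: leq_trans zsr.
  by have := lt_le_trans (c1 _ si) (le_r _ _ ji ir); rewrite xi xj ltxx.
have ir : (i.+1 < size r)%N by exact: leq_ltn_trans rj.
by have := le_lt_trans (le_r _ _ ij rj) (c2 _ ir); rewrite xi xj ltxx.
Qed.

Lemma preceq_interleave (R : realType) (g f : {poly R}) :
  standard f -> g != 0 -> f != 0 -> preceq g f ->
  exists s r : seq R, [/\ g = lead_coef g *: rootprod s,
    f = lead_coef f *: rootprod r & interleave s r].
Proof.
move=> fs g0 f0 [/chain_of_by|[a [b [c [gE fE]]]]|[_ f00]|[g00 _]].
- move=> [s [r [_ _ gE fE [ss sr zsr c1 c2]]]].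
  by exists s, r; split=> //; exact: interleave_of_nth.
(* A constant against a polynomial of degree at most one: no zero on the left and at most one on the
   right. *)
- have gE' : g = lead_coef g *: 1 by rewrite gE lead_coefC alg_polyC.
  have [b0|b0] := eqVneq b 0.
    exists [::], [::]; rewrite big_nil; split=> //.
    by rewrite fE b0 scale0r add0r lead_coefC alg_polyC.
  exists [::], [:: - (c / b)]; rewrite big_nil big_seq1; split=> //.
    have -> : lead_coef f = b.
      rewrite fE lead_coefDl ?lead_coefZ ?lead_coefX ?mulr1 //.
      by rewrite size_scale // size_polyX size_polyC; case: eqP.
    by rewrite fE scalerBr scale_polyC mulrN polyCN opprK mulrC divfK.
  by move=> P _ /=; case: (P _).
- by rewrite f00 eqxx in f0.
- by rewrite g00 eqxx in g0.
Qed.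

(** * Dividing out the common zeros *)

Lemma standard_gt0 (R : realType) (p : {poly R}) :
  standard p -> p != 0 -> 0 < lead_coef p.
Proof. by case=> // ->; rewrite eqxx. Qed.

Lemma preceq_coprime (R : realType) (f g : {poly R}) :
  standard f -> g != 0 -> f != 0 -> preceq g f ->
  exists h s r : seq R, [/\ g = rootprod h * (lead_coef g *: rootprod s),
    f = rootprod h * (lead_coef f *: rootprod r),
    forall x, x \in s -> x \notin r & interleave s r].
Proof.
move=> fs g0 f0 /(preceq_interleave fs g0 f0)[s [r [gE fE]]].
move=> /interleave_common[h [s' [r' [ps pr /hasPn N I]]]].
exists h, s', r'; split=> //.
  by rewrite {1}gE (perm_big _ ps) big_cat scalerAr.
by rewrite {1}fE (perm_big _ pr) big_cat scalerAr.
Qed.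

(** Above a zero of the reduced [g], the reduced [f] has one zero more than the reduced [g], hence
    the negative sign. If [f] is zero, all of [g] except its leading coefficient goes into the
    common factor and the sign condition is vacuous. *)
Lemma preceq_reduce_c (R : realType) (f g : {poly R}) :
  standard f -> standard g -> RZ g -> g != 0 -> preceq g f ->
  exists (h s : seq R) (f1 g1 : {poly R}),
    [/\ f = rootprod h * f1, g = rootprod h * g1,
      g1 = lead_coef g1 *: rootprod s, uniq s &
      forall x, x \in s -> (-1) ^+ count (> x) s * f1.[x] < 0].
Proof.
move=> fs gs gRZ g0 gf; have [f0|f0] := eqVneq f 0.
  have [h gE] := RZ_split gRZ; exists h, [::], 0, (lead_coef g)%:P.
  rewrite mulr0 big_nil lead_coefC alg_polyC; split=> //.
  by rewrite {1}gE mulrC mul_polyC.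
have [h [s [r [gE fE N I]]]] := preceq_coprime fs g0 f0 gf.
exists h, s, (lead_coef f *: rootprod r), (lead_coef g *: rootprod s).
have lf := standard_gt0 fs f0.
split=> //.
- by rewrite lead_coefZ (monicP (monic_prod_XsubC _ _ _)) mulr1.
- by apply: uniq_of_count => x xs; have [] := interleave_count_l I xs (N _ xs).
move=> x xs; have [_ cr] := interleave_count_l I xs (N _ xs).
rewrite hornerZ mulrCA pmulr_rlt0 //.
by have := sign_horner_roots (N _ xs); rewrite cr exprS mulN1r mulNr oppr_gt0.
Qed.

Lemma preceq_reduce_d (R : realType) (f g : {poly R}) :
  standard f -> standard g -> RZ f -> f != 0 -> preceq g f ->
  exists (h r : seq R) (f1 g1 : {poly R}),
    [/\ f = rootprod h * f1, g = rootprod h * g1,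
      f1 = lead_coef f1 *: rootprod r, uniq r &
      forall x, x \in r -> 0 < (-1) ^+ count (> x) r * g1.[x]].
Proof.
move=> fs gs fRZ f0 gf; have [g0|g0] := eqVneq g 0.
  have [h fE] := RZ_split fRZ; exists h, [::], (lead_coef f)%:P, 0.
  rewrite mulr0 big_nil lead_coefC alg_polyC; split=> //.
  by rewrite {1}fE mulrC mul_polyC.
have [h [s [r [gE fE N I]]]] := preceq_coprime fs g0 f0 gf.
exists h, r, (lead_coef f *: rootprod r), (lead_coef g *: rootprod s).
have lg := standard_gt0 gs g0.
have N' x : x \in r -> x \notin s by apply: contraL; exact: N.
split=> //.
- by rewrite lead_coefZ (monicP (monic_prod_XsubC _ _ _)) mulr1.
- by apply: uniq_of_count => x xr; have [] := interleave_count_r I xr (N' _ xr).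
move=> x xr; have [_ cr] := interleave_count_r I xr (N' _ xr).
by rewrite hornerZ mulrCA pmulr_rgt0 // -cr sign_horner_roots // N'.
Qed.

(** A zero [q] would make the right-hand side -oo. The degree bound on [G] thus also shows that [g],
    respectively [f], is nonzero. *)
Lemma deg_le (R : realType) (p q : {poly R}) (n : nat) :
  p != 0 -> (deg p <= deg q + (n%:Z)%:E)%E ->
  q != 0 /\ (size p <= size q + n)%N.
Proof.
move=> p0; rewrite (deg_neq0 p0).
have [->|q0] := eqVneq q 0; first by rewrite /deg eqxx.
rewrite (deg_neq0 q0) -EFinD lee_fin -PoszD lez_nat.
have := size_poly_gt0 p; have := size_poly_gt0 q.
by rewrite p0 q0; split=> //; lia.
Qed.

Lemma lead_coef_rootprodM (R : idomainType) (h : seq R) (p : {poly R}) :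
  lead_coef (rootprod h * p) = lead_coef p.
Proof. by rewrite lead_coef_monicM ?monic_prod_XsubC. Qed.

Lemma size_rootprodM (R : idomainType) (h : seq R) (p : {poly R}) :
  p != 0 -> size (rootprod h * p) = (size h + size p)%N.
Proof.
by move=> p0; rewrite size_monicM ?monic_prod_XsubC // size_prod_XsubC.
Qed.

Lemma split_interleave (R : realType) (f g F G a b c d : {poly R}) :
  standard f -> standard g -> 0 < lead_coef F -> 0 < lead_coef G ->
  F = a * f + b * g -> G = c * f + d * g -> (size F <= (size G).+1)%N ->
  RZ f -> RZ g -> preceq g f ->
  (forall x : R, G.[x] = 0 -> 0 <= (a * d - b * c).[x]) ->
  (positive_constant c /\ (deg G <= deg g + 1)%E) \/
    (positive_constant d /\ (deg G <= deg f)%E) ->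
  exists t y : seq R, [/\ G = lead_coef G *: rootprod t,
    F = lead_coef F *: rootprod y & interleave t y].
Proof.
move=> fs gs lF lG FE GE szF fRZ gRZ gf Delta cd.
have [F0 G0] := (lead_coef_gt0_neq0 lF, lead_coef_gt0_neq0 lG).
(* The cofactors are combined with the same [a], [b], [c], [d], so Delta is unchanged, and zeros of
   [G1] are zeros of [G]. The common factor is monic, so leading coefficients persist; adjoining [h]
   to both lists brings the conclusion back. *)
have transfer (h : seq R) (f1 g1 : {poly R}) :
    f = rootprod h * f1 -> g = rootprod h * g1 ->
    let F1 := a * f1 + b * g1 in let G1 := c * f1 + d * g1 in
    [/\ 0 < lead_coef F1, 0 < lead_coef G1, size G = (size h + size G1)%N,
      (size F1 <= (size G1).+1)%N &
      (forall x, G1.[x] = 0 -> 0 <= (a * d - b * c).[x])] /\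
    ((exists t y : seq R, [/\ G1 = lead_coef G1 *: rootprod t,
      F1 = lead_coef F1 *: rootprod y & interleave t y]) ->
    exists t y : seq R, [/\ G = lead_coef G *: rootprod t,
      F = lead_coef F *: rootprod y & interleave t y]).
  move=> fE gE F1 G1.
  have FE1 : F = rootprod h * F1 by rewrite FE fE gE /F1; ring.
  have GE1 : G = rootprod h * G1 by rewrite GE fE gE /G1; ring.
  have lF1 : lead_coef F = lead_coef F1 by rewrite FE1 lead_coef_rootprodM.
  have lG1 : lead_coef G = lead_coef G1 by rewrite GE1 lead_coef_rootprodM.
  have F10 : F1 != 0 by rewrite -lead_coef_eq0 -lF1 lead_coef_eq0.
  have G10 : G1 != 0 by rewrite -lead_coef_eq0 -lG1 lead_coef_eq0.
  have szG1 : size G = (size h + size G1)%N by rewrite GE1 size_rootprodM.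
  split.
    rewrite -lF1 -lG1; split=> //.
      by move: szF; rewrite szG1 FE1 size_rootprodM // -addnS leq_add2l.
    by move=> x Gx; apply: Delta; rewrite GE1 hornerM Gx mulr0.
  case=> t [y [tE yE I]]; exists (h ++ t), (h ++ y); split.
  - by rewrite big_cat /= scalerAr lG1 -tE.
  - by rewrite big_cat /= scalerAr lF1 -yE.
  - exact/interleave_cat.
have gt0M (h : seq R) (p q : {poly R}) :
    standard p -> p != 0 -> p = rootprod h * q -> 0 < lead_coef q /\ q != 0.
  move=> ps p0 pE; have := standard_gt0 ps p0.
  rewrite pE lead_coef_rootprodM => lq; split=> //.
  exact: lead_coef_gt0_neq0.
case: cd => -[[k [k0 kE]] dG].
  have [g0 szG] := deg_le G0 dG.
  have [h [s [f1 [g1 [fE gE sE us sgn]]]]] := preceq_reduce_c fs gs gRZ g0 gf.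
  have [[lF1 lG1 szGE szF1 D1]] := transfer h f1 g1 fE gE; apply.
  have [lg1 g10] := gt0M _ _ _ gs g0 gE.
  apply: (interleave_const_c (erefl _) (erefl _) lF1 lG1 szF1 k0 D1 kE
    lg1 sE us sgn).
  by move: szG; rewrite szGE gE size_rootprodM // addn1 -addnS leq_add2l.
have [|f0 szG] := @deg_le _ G f 0 G0; first by rewrite adde0.
have [h [r [f1 [g1 [fE gE rE ur sgn]]]]] := preceq_reduce_d fs gs fRZ f0 gf.
have [[lF1 lG1 szGE szF1 D1]] := transfer h f1 g1 fE gE; apply.
have [lf1 f10] := gt0M _ _ _ fs f0 fE.
apply: (interleave_const_d (erefl _) (erefl _) lF1 lG1 szF1 k0 D1 kE
  lf1 rE ur sgn).
by move: szG; rewrite szGE fE size_rootprodM // addn0 leq_add2l.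
Qed.

Unset Implicit Arguments.

Theorem theorem2p6 (R : realType) (f g F G a b c d : {poly R})
  (f_std : standard f) (g_std : standard g)
  (F_std : standard F) (G_std : standard G)
  (F_def : F = a * f + b * g) (G_def : G = c * f + d * g)
  (deg_FG : deg F = deg G \/ deg F = (deg G + 1)%E)
  (f_RZ : RZ f) (g_RZ : RZ g) (g_f : preceq g f)
  (Delta_ge0 : forall x : R, G.[x] = 0 -> 0 <= (a * d - b * c).[x])
  (c_or_d : (positive_constant c /\ (deg G <= deg g + 1)%E) \/
            (positive_constant d /\ (deg G <= deg f)%E)) :
  [/\ RZ F, RZ G & preceq G F] /\
  (prec g f -> (forall x : R, G.[x] = 0 -> 0 < (a * d - b * c).[x]) ->
   prec G F).
Proof.
(* By Cramer's rule, Delta f = d F - b G and Delta g = a G - c F, so a common zero of [F] and [G]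
   where Delta > 0 would be a common zero of [f] and [g]. *)
have no_common : prec g f ->
    (forall x : R, G.[x] = 0 -> 0 < (a * d - b * c).[x]) ->
    forall x, G.[x] = 0 -> F.[x] <> 0.
  move=> gf Delta_gt0 x Gx Fx; have D := Delta_gt0 x Gx.
  have fx : f.[x] = 0.
    apply: (mulfI (lt0r_neq0 D)); rewrite mulr0.
    have -> : (a * d - b * c).[x] * f.[x] = d.[x] * F.[x] - b.[x] * G.[x].
      by rewrite F_def G_def !hornerE; ring.
    by rewrite Fx Gx !mulr0 subrr.
  apply: (prec_no_common_root gf _ fx).
  apply: (mulfI (lt0r_neq0 D)); rewrite mulr0.
  have -> : (a * d - b * c).[x] * g.[x] = a.[x] * G.[x] - c.[x] * F.[x].
    by rewrite F_def G_def !hornerE; ring.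
  by rewrite Fx Gx !mulr0 subrr.
(* If [G] is zero, both degree alternatives give [deg F] = -oo, so [F] is zero and the convention
   applies. The strict hypotheses are then contradictory: every point, for instance 0, is a common
   zero. *)
have [G0|G0] := eqVneq G 0.
  have F0 : F = 0.
    by apply/eqP; move: deg_FG; rewrite G0 /deg eqxx; case: (F == 0) => // -[].
  have RZ0 : RZ (0 : {poly R}) by left.
  split; first by rewrite F0 G0; split=> //; apply: Or43.
  move=> gf Delta_gt0; have := no_common gf Delta_gt0 0.
  by rewrite F0 G0 !horner0 => /(_ erefl).
have [F0 szF] : F != 0 /\ (size F <= (size G).+1)%N.
  have F0 : F != 0.
    move: deg_FG; rewrite (deg_neq0 G0) {1 2}/deg; case: eqP => // _.
    by case.
  split=> //; rewrite -addn1; apply: (deg_le F0 _).2.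
  by case: deg_FG => ->; rewrite (deg_neq0 G0) -EFinD lee_fin; lia.
have [t [y [GE FE I]]] := split_interleave f_std g_std (standard_gt0 F_std F0)
  (standard_gt0 G_std G0) F_def G_def szF f_RZ g_RZ g_f Delta_ge0 c_or_d.
split.
  split; [exact: split_RZ FE | exact: split_RZ GE | apply: Or41].
  exact: (by_of_interleave G0 F0 GE FE I).
move=> gf Delta_gt0; apply: (by_of_interleave G0 F0 GE FE I) => x z.
rewrite -(split_root _ G0 GE) -(split_root _ F0 FE) => /eqP Gx /eqP Fz.
have xz : x != z.
  by apply: contra_notN (no_common gf Delta_gt0 x Gx) => /eqP->.
by split=> le; rewrite lt_neqAle le andbT // eq_sym.
Qed.
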